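(* Let $U,\hat U$ be Hilbert spaces, $Q:U\to\hat U$ a bounded linear operator, $w\in\hat U$, $u^{(0)}\in U$, and let $(u^{(n)})_{n\ge0}$ be generated by the steepest-descent recurrence $$r^{(n)}=Q^*(Qu^{(n)}-w),\qquad u^{(n+1)}=u^{(n)}-\alpha_n r^{(n)},\qquad \alpha_n:=\frac{\|r^{(n)}\|^2}{\|Qr^{(n)}\|^2},\qquad n\ge0.$$ (i) If $M_{Q,w}\cap\operatorname{ran}(Q^* )\neq\emptyset$ and $u^{(0)}\in\operatorname{ran}(Q^* )\oplus\operatorname{ran}(Q^* )^\perp$, then $u^{(n)}$ converges in norm to $P_{M_{Q,w}}u^{(0)}$. (ii) If $M_{Q,w}=\emptyset$, then $\|u^{(n)}\|$ tends to $\infty$.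
   Context: $Q^*$ is the adjoint of $Q$ and $\operatorname{ran}$ denotes range. $M_{Q,w}:=\{u\in U:\|Qu-w\|=\inf_{v\in U}\|Qv-w\|\}$; $P_S$ is the orthogonal projection onto a nonempty closed affine subspace $S$. The iteration is terminated as soon as $r^{(n)}=0$, in which case the sequence is regarded as constant from then on ($u^{(m)}=u^{(n)}$ for $m\ge n$). *)

(* Defs.v *)
From HB Require Import structures.
From mathcomp Require Import all_boot all_order all_algebra.
From mathcomp Require Import sesquilinear complex.
From mathcomp Require Import all_classical all_reals all_analysis.

Set Implicit Arguments.
Unset Strict Implicit.
Unset Printing Implicit Defensive.

Import Order.TTheory GRing.Theory Num.Theory.
Import numFieldNormedType.Exports.

Local Open Scope classical_set_scope.
Local Open Scope ring_scope.

(* Hilbert spaces may be real or complex. *)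
Variant scalar_kind := RealScalars | ComplexScalars.

Definition scalars (R : realType) (k : scalar_kind) : numFieldType :=
  match k with
  | RealScalars => R
  | ComplexScalars => R[i]
  end.

Definition sconj (R : realType) (k : scalar_kind) : scalars R k -> scalars R k :=
  match k with
  | RealScalars => idfun
  | ComplexScalars => @Num.conj R[i]
  end.

(* The inner product is linear in its first argument and conjugate-linear in
   its second one. *)
HB.mixin Record CompleteNormedModule_isHilbert
    (R : realType) (k : scalar_kind) (U : Type)
    of CompleteNormedModule (scalars R k) U := {
  inner_subdef : {dot U for @sconj R k} ;
  normE_subproof : forall x : U, `|x| ^+ 2 = inner_subdef x x
}.

#[short(type="hilbertType")]
HB.structure Definition Hilbert (R : realType) (k : scalar_kind) :=
  {U of CompleteNormedModule (scalars R k) U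
      & CompleteNormedModule_isHilbert R k U}.

Definition inner (R : realType) (k : scalar_kind) (U : hilbertType R k) :
  {dot U for @sconj R k} := inner_subdef.
Arguments inner {R k U}.

Lemma normE_inner (R : realType) (k : scalar_kind) (U : hilbertType R k) (x : U) :
  `|x| ^+ 2 = inner x x.
Proof. exact: normE_subproof. Qed.

Section HilbertDefs.
Variables (R : realType) (k : scalar_kind).

Definition orthogonal_complement (U : hilbertType R k) (A : set U) : set U :=
  [set x | forall a, A a -> inner x a = 0].

(* [P_S x]: the point p of S with x - p orthogonal to the direction of S.  It
   exists and is unique when S is a nonempty closed affine subspace; [get]
   returns a default point when there is no such p. *)
Definition orthogonal_projection (U : hilbertType R k) (S : set U) (x : U) : U :=
  get [set p | S p /\ forall s, S s -> inner (x - p) (s - p) = 0].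

Variables U V : hilbertType R k.

Definition bounded_operator (Q : {linear U -> V}) : Prop :=
  exists M : scalars R k, forall x, `|Q x| <= M * `|x|.

(* [adjoint Q v] is the unique z with <Q x, v> = <x, z> for all x; it exists by
   the Riesz representation theorem when Q is bounded. *)
Definition adjoint (Q : {linear U -> V}) (v : V) : U :=
  get [set z | forall x, inner (Q x) v = inner x z].

(* M_{Q,w}.  [infimums A] is the set of greatest lower bounds of A; norms are
   elements of the field of scalars, and the order of R[i] only relates numbers
   with the same imaginary part, so that greatest lower bounds of sets of norms
   are the usual real ones. *)
Definition least_squares_solutions (Q : {linear U -> V}) (w : V) : set U :=
  [set u | infimums (range (fun v : U => `|Q v - w|)) `|Q u - w|].

Definition residual (Q : {linear U -> V}) (w : V) (u : U) : U :=
  adjoint Q (Q u - w).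

Definition step_size (Q : {linear U -> V}) (r : U) : scalars R k :=
  `|r| ^+ 2 / `|Q r| ^+ 2.

(* The test stops the iteration, i.e. makes it stationary, at a zero residual. *)
Definition steepest_descent (Q : {linear U -> V}) (w : V) (u : nat -> U) : Prop :=
  forall n, let r := residual Q w (u n) in
    u n.+1 = if r == 0 then u n else u n - step_size Q r *: r.

End HilbertDefs.

(* Main.v *)
Require Import Defs.
From mathcomp Require Import all_boot all_order all_algebra.
From mathcomp Require Import sesquilinear complex ring lra.
From mathcomp Require Import all_classical all_reals all_analysis.
(** All step sizes are real, so the iteration takes place in the real Hilbert
    spaces underlying U and V.  The objective |Q u_n - w|^2 decreases by
    |r_n|^4 / |Q r_n|^2 >= |r_n|^2 / |Q|^2 at each step, so r_n tends to 0.

    (i) Write u_0 = Q^* v + b with b in the kernel of Q, let Q^* y be a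
    solution, and put p = Q^* y + b.  Then p is the projection of u_0, and the
    errors e_n = u_n - p stay in the range of Q^*: e_n = Q^* d_n with
    d_(n+1) = d_n - alpha_n Q e_n.  The moment inequality
    |r_n|^2 |Q e_n|^2 <= |e_n|^2 |Q r_n|^2 makes |d_n| nonincreasing, so
    |e_n|^2 = <d_n, Q e_n> <= |d_0| |Q e_n|; together with
    |Q e_n|^2 = <e_n, r_n> <= |e_n| |r_n| this gives
    |e_n|^3 <= |d_0|^2 |r_n| -> 0.

    (ii) If |u_n| does not tend to infinity, then infinitely many u_n lie in a
    ball, so the nested closed convex sets {x | |Q^* (Q x - w)| <= 1/(j+1)} all
    meet that ball and hence have a common point, which solves the normal
    equation. *)

Set Implicit Arguments.
Unset Strict Implicit.
Unset Printing Implicit Defensive.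

Import Order.TTheory GRing.Theory Num.Theory.
Import numFieldNormedType.Exports.
Local Open Scope classical_set_scope.
Local Open Scope ring_scope.

(** * Real and complex scalars treated uniformly through their real parts *)

Definition re {R : realType} {k : scalar_kind} : scalars R k -> R :=
  match k with RealScalars => id | ComplexScalars => @complex.Re R end.

Definition ofR {R : realType} {k : scalar_kind} : R -> scalars R k :=
  match k with RealScalars => id | ComplexScalars => real_complex R end.

Section Scalars.
Variables (R : realType) (k : scalar_kind).
Implicit Types (a b : R) (x y : scalars R k).

Lemma reD : {morph @re R k : x y / x + y}.
Proof. by case: k => // -[? ?] [? ?]. Qed.

Lemma reB : {morph @re R k : x y / x - y}.
Proof. by case: k => // -[? ?] [? ?]. Qed.

Lemma re_ofR_mul a x : re (ofR a * x) = a * re x.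
Proof. by case: k x => //= -[c d] /=; rewrite mul0r subr0. Qed.

Lemma ofRM : {morph @ofR R k : a b / a * b}.
Proof. by case: k => // a b; exact: rmorphM. Qed.

Lemma ofRV a : ofR a^-1 = (ofR a)^-1 :> scalars R k.
Proof. by case: k => //; exact: fmorphV. Qed.

Lemma ofR0 : ofR 0 = 0 :> scalars R k.
Proof. by case: k. Qed.

Lemma ofR1 : ofR 1 = 1 :> scalars R k.
Proof. by case: k. Qed.

Lemma ofRN a : ofR (- a) = - ofR a :> scalars R k.
Proof. by case: k => //; exact: rmorphN. Qed.

Lemma ofRK a : re (ofR a : scalars R k) = a.
Proof. by case: k. Qed.

Lemma ofR_le a b : (ofR a <= ofR b :> scalars R k) = (a <= b).
Proof. by case: k => //; rewrite lecE /= eqxx. Qed.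

Lemma ofR_lt a b : (ofR a < ofR b :> scalars R k) = (a < b).
Proof. by case: k => //; rewrite ltcE /= eqxx. Qed.

Lemma re_real x : x \is Num.real -> ofR (re x) = x.
Proof. by case: k x => // x; exact: RRe_real. Qed.

Lemma re_le x y : x <= y -> re x <= re y.
Proof. by case: k x y => // x y; rewrite lecE => /andP[]. Qed.

Lemma re_sconj x : re (sconj x) = re x.
Proof. by case: k x => // -[a b]. Qed.

Lemma sconj_eq0 x : (sconj x == 0) = (x == 0).
Proof. by case: k x => // x; exact: conjC_eq0. Qed.

(** Serves to lift an identity between real parts to one between scalars, by testing it on vectors
    multiplied by a conjugate. *)
Lemma re_mul_conj_eq0 x : re (sconj x * x) = 0 -> x = 0.
Proof.
case: k x => /= [x /eqP|[a b] /= /eqP]; first by rewrite mulf_eq0 orbb => /eqP.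
rewrite mulNr opprK -!expr2 paddr_eq0 ?sqr_ge0 // !sqrf_eq0.
by move=> /andP[/eqP -> /eqP ->].
Qed.

End Scalars.

(** * The underlying real inner product space *)

Definition rdot {R : realType} {k : scalar_kind} {U : hilbertType R k}
  (x y : U) : R := re (inner x y).

Definition rnorm {R : realType} {k : scalar_kind} {U : hilbertType R k}
  (x : U) : R := re `|x|.

Section RealInner.
Variables (R : realType) (k : scalar_kind) (U : hilbertType R k).
Implicit Types (x y z : U) (a : R).

Lemma innerC x y : inner x y = sconj (inner y x).
Proof. by rewrite (@hermitian_subproof _ _ _ _ inner) expr0 mul1r. Qed.

Lemma norm_ofR x : `|x| = ofR (rnorm x).
Proof. by rewrite re_real// normr_real. Qed.

Lemma rnorm_ge0 x : 0 <= rnorm x.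
Proof. by rewrite -(@ofR_le R k) -norm_ofR ofR0. Qed.

Lemma rdotC x y : rdot x y = rdot y x.
Proof. by rewrite /rdot innerC re_sconj. Qed.

Lemma rdotDl x y z : rdot (x + y) z = rdot x z + rdot y z.
Proof. by rewrite /rdot linearDl reD. Qed.

Lemma rdotZl a x y : rdot (ofR a *: x) y = a * rdot x y.
Proof. by rewrite /rdot linearZl_LR re_ofR_mul. Qed.

Lemma rdotNl x y : rdot (- x) y = - rdot x y.
Proof. by rewrite -scaleN1r -ofR1 -ofRN rdotZl mulN1r. Qed.

Lemma rdotDr x y z : rdot x (y + z) = rdot x y + rdot x z.
Proof. by rewrite !(rdotC x) rdotDl. Qed.

Lemma rdotZr a x y : rdot x (ofR a *: y) = a * rdot x y.
Proof. by rewrite !(rdotC x) rdotZl. Qed.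

Lemma rdotNr x y : rdot x (- y) = - rdot x y.
Proof. by rewrite !(rdotC x) rdotNl. Qed.

Lemma rdotBl x y z : rdot (x - y) z = rdot x z - rdot y z.
Proof. by rewrite rdotDl rdotNl. Qed.

Lemma rdotBr x y z : rdot x (y - z) = rdot x y - rdot x z.
Proof. by rewrite rdotDr rdotNr. Qed.

Definition rdotE := (rdotDl, rdotDr, rdotZl, rdotZr, rdotNl, rdotNr).

Lemma rdot0l x : rdot 0 x = 0.
Proof. by rewrite -(subrr x) rdotBl subrr. Qed.

Lemma rdot0r x : rdot x 0 = 0.
Proof. by rewrite rdotC rdot0l. Qed.

Lemma sqr_rnorm x : rnorm x ^+ 2 = rdot x x.
Proof.
by rewrite /rdot -normE_inner norm_ofR [in RHS]expr2 -ofRM ofRK.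
Qed.

Lemma rdot_ge0 x : 0 <= rdot x x.
Proof. by rewrite -sqr_rnorm sqr_ge0. Qed.

Lemma rnorm0_eq0 x : rnorm x = 0 -> x = 0.
Proof. by move=> x0; apply/normr0_eq0; rewrite norm_ofR x0 ofR0. Qed.

Lemma rdot0_eq0 x : rdot x x = 0 -> x = 0.
Proof. by rewrite -sqr_rnorm => /eqP; rewrite sqrf_eq0 => /eqP /rnorm0_eq0. Qed.

Lemma rdot_inj x y : (forall z, rdot z x = rdot z y) -> x = y.
Proof.
by move=> xy; apply/eqP; rewrite -subr_eq0; apply/eqP/rdot0_eq0;
  rewrite rdotBr xy subrr.
Qed.

Lemma rnormD x y : rnorm (x + y) <= rnorm x + rnorm y.
Proof. by rewrite -reD re_le// ler_normD. Qed.

Lemma rnormN x : rnorm (- x) = rnorm x.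
Proof. by rewrite /rnorm normrN. Qed.

Lemma rnormZ a x : 0 <= a -> rnorm (ofR a *: x) = a * rnorm x.
Proof.
move=> a0; have a0' : ofR 0 <= ofR a :> scalars R k by rewrite ofR_le.
rewrite ofR0 in a0'; rewrite /rnorm normrZ (ger0_norm a0').
exact: re_ofR_mul.
Qed.

Lemma rnormB x y : rnorm (x - y) = rnorm (y - x).
Proof. by rewrite -rnormN opprB. Qed.

Lemma Cauchy_Schwarz x y : rdot x y ^+ 2 <= rdot x x * rdot y y.
Proof.
have [y0|y0] := eqVneq (rdot y y) 0.
  by rewrite (rdot0_eq0 y0) !rdot0r expr0n mulr0.
have yy0 : 0 < rdot y y by rewrite lt_neqAle eq_sym y0 rdot_ge0.
(* This vector is [rdot y y] times the component of [x] orthogonal to [y]; the scaling avoids a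
   division. *)
have := rdot_ge0 (ofR (rdot y y) *: x - ofR (rdot x y) *: y).
rewrite !rdotE (rdotC y x).
rewrite [leRHS](_ : _ = rdot y y * (rdot x x * rdot y y - rdot x y ^+ 2)); last by ring.
by rewrite pmulr_rge0// subr_ge0.
Qed.

Lemma parallelogram x y : rdot (x - y) (x - y) =
  2 * rdot x x + 2 * rdot y y - 4 * rdot (ofR 2^-1 *: (x + y)) (ofR 2^-1 *: (x + y)).
Proof. by rewrite !rdotE (rdotC y x); field. Qed.

Lemma rdot_le_rnorm x y : rdot x y <= rnorm x * rnorm y.
Proof.
apply: le_trans (ler_norm _) _.
rewrite -(@ler_pXn2r _ 2) ?nnegrE ?normr_ge0 ?mulr_ge0 ?rnorm_ge0//.
by rewrite real_normK ?num_real// exprMn !sqr_rnorm Cauchy_Schwarz.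
Qed.

(** For nonzero y the quadratic in t is smallest at t = -<x,y>/|y|^2, with value |x|^2 -
    <x,y>^2/|y|^2; minimality at t = 0 forces <x,y> = 0. *)
Lemma rdot_min_orth x y : (forall t, rdot x x <= rdot (x + ofR t *: y) (x + ofR t *: y)) ->
  rdot x y = 0.
Proof.
move=> min; have [y0|y0] := eqVneq (rdot y y) 0.
  by rewrite (rdot0_eq0 y0) rdot0r.
have yy0 : 0 < rdot y y by rewrite lt_neqAle eq_sym y0 rdot_ge0.
have := min (- (rdot x y / rdot y y)).
rewrite !rdotE (rdotC y x); set a := rdot x x; set b := rdot y y; set c := rdot x y.
rewrite [leRHS](_ : _ = a - c ^+ 2 / b); last by field.
rewrite lerBrDl gerDr le_eqVlt ltNge divr_ge0 ?sqr_ge0 ?(ltW yy0)// orbF.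
by rewrite mulf_eq0 invr_eq0 (negPf y0) orbF sqrf_eq0 => /eqP.
Qed.

Lemma cvgPrnorm (u : nat -> U) (l : U) :
  (forall e : R, 0 < e -> exists N, forall n, (N <= n)%N -> rnorm (u n - l) < e) ->
  u n @[n --> \oo] --> l.
Proof.
move=> ul; apply/cvgrPdist_lt => e e0.
have [N uN] := ul (re e) ltac:(by rewrite -(@ofR_lt R k) ofR0 re_real// gtr0_real).
exists N => // n /= Nn; rewrite norm_ofR -rnormN opprB.
by rewrite -[ltRHS]re_real ?gtr0_real// ofR_lt uN.
Qed.

Lemma rnorm_complete (u : nat -> U) :
  (forall e : R, 0 < e -> exists N, forall m n, (N <= m)%N -> (N <= n)%N ->
    rnorm (u m - u n) < e) ->
  exists l, forall e : R, 0 < e -> exists N, forall n, (N <= n)%N -> rnorm (u n - l) < e.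
Proof.
move=> uC.
have /cauchy_cvgP ul : cauchy (u n @[n --> \oo]).
  apply: cauchy_exP => e e0.
  have [N uN] := uC (re e) ltac:(by rewrite -(@ofR_lt R k) ofR0 re_real// gtr0_real).
  exists (u N), N => // n /= Nn; rewrite -ball_normE /= norm_ofR.
  by rewrite -[ltRHS]re_real ?gtr0_real// ofR_lt uN.
exists (lim (u n @[n --> \oo])) => e e0.
have /cvgrPdist_lt /(_ (ofR e)) := ul.
rewrite -[0]ofR0 ofR_lt => /(_ e0)[N _ uN]; exists N => n /uN.
by rewrite norm_ofR ofR_lt rnormB.
Qed.

End RealInner.

(** * Nested convex sets, Riesz representation and adjoints *)

Section NestedConvex.
Variables (R : realType) (k : scalar_kind) (U : hilbertType R k).

Definition rclosed (C : set U) :=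
  forall l, (forall e : R, 0 < e -> exists2 x, C x & rnorm (x - l) < e) -> C l.

(** Near-minimizers of the norm on the [C n] form a Cauchy sequence by the parallelogram law, for
    which stability under midpoints suffices. A constant sequence of sets yields Riesz
    representation, a shrinking one a solution of the normal equation. *)
Lemma nested_convex_min (C : nat -> set U) (K : R) :
  (forall m n, (m <= n)%N -> C n `<=` C m) ->
  (forall n x y, C n x -> C n y -> C n (ofR 2^-1 *: (x + y))) ->
  (forall n, rclosed (C n)) ->
  (forall n, exists2 x, C n x & rdot x x <= K) ->
  exists2 l, (forall n, C n l) &
    forall y, (forall n, C n y) -> rdot l l <= rdot y y.
Proof.
move=> Cdecr Cmid Ccl Cbd.
pose S n := [set rdot x x | x in C n].
have Slb n : has_lbound (S n) by exists 0 => _ [x _ <-]; exact: rdot_ge0.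
have Sinf n : has_inf (S n).
  by split=> //; have [x Cx _] := Cbd n; exists (rdot x x), x.
pose d n : R := inf (S n).
have d_le n x : C n x -> d n <= rdot x x by move=> Cx; apply: ge_inf => //; exists x.
have dub : has_ubound (range d).
  by exists K => _ [n _ <-]; have [x /d_le Cx] := Cbd n; exact: le_trans.
pose D := sup (range d).
have d_leD n : d n <= D by apply: ub_le_sup => //; exists n.
have /choice[x xP] : forall n, exists x, C n x /\ rdot x x < d n + n.+1%:R^-1.
  move=> n; have [_ [x Cx <-] xlt] := @inf_adherent _ (S n) n.+1%:R^-1 ltac:(by []) (Sinf n).
  by exists x.
have xC m n : (m <= n)%N -> C m (x n) by move=> mn; apply: (Cdecr _ _ mn); case: (xP n).
have invn (h : R) : 0 < h -> exists N, forall n, (N <= n)%N -> n.+1%:R^-1 < h :> R.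
  move=> h0; have [N] := ltr_add_invr h0; rewrite add0r => hN; exists N => n Nn.
  by apply: le_lt_trans hN; rewrite lef_pV2 ?posrE// ler_nat.
have [|l xl] := @rnorm_complete _ _ _ x.
  (* For late m and n the midpoint lies in [C N0], so its squared norm is at least [d N0] > D - h,
     while both points have squared norm below D + h. The parallelogram law bounds the squared
     distance by 4 (D + h) - 4 (D - h) = 8 h = e^2. *)
  move=> e e0; pose h : R := e ^+ 2 / 8.
  have h0 : 0 < h by rewrite divr_gt0// exprn_gt0.
  have [_ [N0 _ <-] dN0] := @sup_adherent _ (range d) h h0
    (conj (ex_intro _ _ (ex_intro2 _ _ 0%N I erefl)) dub).
  have [N1 N1h] := invn _ h0.
  exists (maxn N0 N1) => m n; rewrite !geq_max => /andP[m0 m1] /andP[n0 n1].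
  rewrite -(@ltr_pXn2r _ 2) ?nnegrE ?rnorm_ge0 ?(ltW e0)// sqr_rnorm.
  have := d_le _ _ (Cmid _ _ _ (xC _ _ m0) (xC _ _ n0)).
  have [_ xm] := xP m; have [_ xn] := xP n.
  move: dN0; rewrite -/D parallelogram (_ : e ^+ 2 = 8 * h); last by rewrite /h; field.
  move: (d_leD m) (d_leD n) (N1h _ m1) (N1h _ n1) xm xn.
  move: (rdot _ _) (rdot _ _) (rdot _ _) => r s t.
  clearbody D h.
  move: (d m) (d n) (d N0) m.+1%:R^-1 n.+1%:R^-1 => a b c p q.
  by lra.
have lC n : C n l.
  apply: Ccl => e e0; have [N xN] := xl _ e0.
  by exists (x (maxn n N)); rewrite ?xN ?leq_maxr//; apply: xC; rewrite leq_maxl.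
(* If |y| < |l|, then late points x_n, closer to l than half the gap, have norm above (|l| + |y|) /
   2. But |x_n|^2 < [d n] + 1/(n+1) <= |y|^2 + 1/(n+1), which is eventually smaller. *)
exists l => // y yC; rewrite leNgt; apply/negP => yl.
have ltyl : rnorm y < rnorm l.
  by rewrite -(@ltr_pXn2r _ 2) ?nnegrE ?rnorm_ge0// !sqr_rnorm.
have y0 := rnorm_ge0 y.
have gap (a b : R) : 0 <= b -> b < a -> 0 < ((a + b) / 2) ^+ 2 - b ^+ 2.
  by move=> b0 ba; rewrite subr_gt0 ltr_pXn2r ?nnegrE//; lra.
have [N xN] := xl ((rnorm l - rnorm y) / 2) ltac:(by rewrite divr_gt0// subr_gt0).
have [N1 N1h] := invn _ (gap _ _ y0 ltyl).
have := N1h (maxn N N1) (leq_maxr _ _); have := xN (maxn N N1) (leq_maxl _ _).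
have := d_le _ _ (yC (maxn N N1)); have [_] := xP (maxn N N1).
rewrite -!sqr_rnorm.
have := rnormD (x (maxn N N1)) (l - x (maxn N N1)).
rewrite addrC subrK rnormB.
have := rnorm_ge0 (x (maxn N N1)); move: y0 ltyl.
move: (rnorm l) (rnorm y) (rnorm (x _)) (rnorm (l - _)) (d _) _^-1 => a b p q c h.
move=> b0 ba p0 apq pch cb hlt qlt.
have : ((a + b) / 2) ^+ 2 < p ^+ 2 by rewrite ltr_pXn2r ?nnegrE//; lra.
by lra.
Qed.

End NestedConvex.

Section Riesz.
Variables (R : realType) (k : scalar_kind) (U : hilbertType R k).

(** Let l be the point of least norm on the hyperplane g = 1. It is orthogonal to the kernel of g,
    which contains x - g(x) l, so l / |l|^2 represents g. *)
Lemma real_Riesz (g : U -> R) (M : R) :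
  {morph g : x y / x + y} -> (forall a x, g (ofR a *: x) = a * g x) ->
  (forall x, g x <= M * rnorm x) -> exists z, forall x, g x = rdot x z.
Proof.
move=> gD gZ gM.
have gN x : g (- x) = - g x by rewrite -scaleN1r -ofR1 -ofRN gZ mulN1r.
have [g0|] := pselect (forall x, g x = 0); first by exists 0 => x; rewrite rdot0r.
move=> /existsNP[x1 /eqP gx1].
have [||||l gl lmin] := @nested_convex_min _ _ U (fun=> [set x | g x = 1])
    (rdot (ofR (g x1)^-1 *: x1) (ofR (g x1)^-1 *: x1)).
- by move=> m n _ y gy.
- by move=> _ x y /= gx gy; rewrite gZ gD gx gy mulVf ?pnatr_eq0.
- move=> _ l ll /=; apply/eqP; rewrite eq_le -[X in X && _]subr_le0 -[X in _ && X]subr_le0; apply/andP.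
  have small e : 0 < e -> exists2 x, g x = 1 & M * rnorm (x - l) < e.
    (* The sign of [M] is unknown; [|M| + 1] is a positive divisor that dominates it. *)
    move=> e0; have M1 : 0 < `|M| + 1 by rewrite ltr_wpDl.
    have [x /= gx xl] := ll (e / (`|M| + 1)) ltac:(by rewrite divr_gt0).
    exists x => //; apply: le_lt_trans (_ : (`|M| + 1) * rnorm (x - l) < e).
      by rewrite ler_wpM2r ?rnorm_ge0// ler_wpDr// ler_norm.
    by rewrite mulrC -ltr_pdivlMr.
  split; rewrite leNgt; apply/negP => /small[x gx]; apply/negP; rewrite -leNgt.
    by rewrite -[X in _ - X]gx -gN -gD rnormB.
  by rewrite -[X in X - _]gx -gN -gD.
- by move=> _; exists (ofR (g x1)^-1 *: x1) => //=; rewrite gZ mulVf.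
have {}gl := gl 0%N; rewrite /= in gl.
have l0 : rdot l l != 0.
  apply/eqP => /rdot0_eq0 l0; move: gl; rewrite l0 -(subrr 0) gD gN subrr => /eqP.
  by rewrite eq_sym oner_eq0.
have orth y : g y = 0 -> rdot l y = 0.
  move=> gy; apply: rdot_min_orth => t; apply: lmin => _ /=.
  by rewrite gD gZ gy mulr0 addr0.
exists (ofR (rdot l l)^-1 *: l) => x.
have := orth (x - ofR (g x) *: l) ltac:(by rewrite gD gN gZ gl mulr1 subrr).
rewrite rdotBr !rdotZr (rdotC l x) => /eqP; rewrite subr_eq0 => /eqP ->.
by rewrite mulrCA mulVf// mulr1.
Qed.

End Riesz.

Section Adjoint.
Variables (R : realType) (k : scalar_kind) (U V : hilbertType R k).
Variable Q : {linear U -> V}.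
Hypothesis hQ : bounded_operator Q.

Lemma bounded_rnorm : exists2 M, 0 < M & forall x, rnorm (Q x) <= M * rnorm x.
Proof.
have [M QM] := hQ; exists (`|re M| + 1) => [|x]; first by rewrite ltr_wpDl.
apply: le_trans (_ : re M * rnorm x <= _); last first.
  by rewrite ler_wpM2r ?rnorm_ge0// ler_wpDr// ler_norm.
by rewrite mulrC -re_ofR_mul -norm_ofR mulrC re_le.
Qed.

Lemma inner_adjoint x v : inner (Q x) v = inner x (adjoint Q v).
Proof.
apply: (@getPex _ [set z | forall x, inner (Q x) v = inner x z]) => {x}.
have [M M0 QM] := bounded_rnorm.
have [|||z zP] := @real_Riesz _ _ U (fun x => rdot (Q x) v) (M * rnorm v).
- by move=> x y; rewrite linearD rdotDl.
- by move=> a x; rewrite linearZ rdotZl.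
- move=> x; apply: le_trans (rdot_le_rnorm _ _) _.
  by rewrite mulrAC ler_wpM2r ?rnorm_ge0.
(* With c = <Q x, v> - <x, z>, the real identity applied to the vector conj(c) x says that the real
   part of conj(c) c vanishes. *)
exists z => x; apply/eqP; rewrite -subr_eq0; apply/eqP/re_mul_conj_eq0.
rewrite mulrBr -!linearZl_LR -linearZ.
by rewrite reB; apply/eqP; rewrite subr_eq0; apply/eqP; exact: zP.
Qed.

Lemma rdot_adjoint x v : rdot (Q x) v = rdot x (adjoint Q v).
Proof. by rewrite /rdot inner_adjoint. Qed.

Lemma adjointD : {morph adjoint Q : v w / v + w}.
Proof.
by move=> v w; apply: rdot_inj => z; rewrite rdotDr -!rdot_adjoint rdotDr.
Qed.

Lemma adjointZ a v : adjoint Q (ofR a *: v) = ofR a *: adjoint Q v.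
Proof. by apply: rdot_inj => z; rewrite rdotZr -!rdot_adjoint rdotZr. Qed.

Lemma adjointN v : adjoint Q (- v) = - adjoint Q v.
Proof. by apply: rdot_inj => z; rewrite rdotNr -!rdot_adjoint rdotNr. Qed.

Lemma adjointB : {morph adjoint Q : v w / v - w}.
Proof. by move=> v w; rewrite adjointD adjointN. Qed.

Lemma rnorm_adjoint M v : 0 <= M -> (forall x, rnorm (Q x) <= M * rnorm x) ->
  rnorm (adjoint Q v) <= M * rnorm v.
Proof.
move=> M0 QM; set z := adjoint Q v; have z0 := rnorm_ge0 z.
have [->|zn0] := eqVneq (rnorm z) 0; first by rewrite mulr_ge0// rnorm_ge0.
have zgt0 : 0 < rnorm z by rewrite lt_neqAle eq_sym zn0.
rewrite -(ler_pM2l zgt0) -expr2 sqr_rnorm -rdot_adjoint.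
apply: le_trans (rdot_le_rnorm _ _) _.
by rewrite mulrCA mulrA ler_wpM2r ?rnorm_ge0// QM.
Qed.

End Adjoint.

(** * Steepest descent *)

Section Descent.
Variables (R : realType) (k : scalar_kind) (U V : hilbertType R k).
Variable Q : {linear U -> V}.
Hypothesis hQ : bounded_operator Q.
Variable w : V.
Local Notation res := (residual Q w).

Lemma residualB x y : res x - res y = adjoint Q (Q (x - y)).
Proof. by rewrite -adjointB// opprB addrA subrK linearB. Qed.

Lemma least_squaresP p : least_squares_solutions Q w p <->
  forall v, rnorm (Q p - w) <= rnorm (Q v - w).
Proof.
split=> [[lb _] v|pmin].
  by apply/re_le/lb; exists v.
split=> [_ [v _ <-]|y]; first by rewrite !norm_ofR ofR_le.
by apply; exists p.
Qed.

(** Minimality along each line p + t z makes Q p - w orthogonal to Q z. Conversely, Q v - w = Q (v -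
    p) + (Q p - w) is then an orthogonal sum, and Pythagoras applies. *)
Lemma normal_equation p : least_squares_solutions Q w p <-> res p = 0.
Proof.
rewrite least_squaresP; split=> [pmin|p0 v].
  apply: rdot_inj => z; rewrite rdot0r -rdot_adjoint// rdotC.
  apply: rdot_min_orth => t; rewrite -!sqr_rnorm ler_pXn2r ?nnegrE ?rnorm_ge0//.
  by rewrite addrAC -linearZ -linearD.
rewrite -(@ler_pXn2r _ 2) ?nnegrE ?rnorm_ge0// !sqr_rnorm.
have -> : Q v - w = Q (v - p) + (Q p - w) by rewrite linearB addrA subrK.
move: p0; rewrite /residual; move: (Q p - w) => g g0.
rewrite rdotDl !rdotDr (rdotC g (Q _)) (rdot_adjoint hQ _ g) g0 rdot0r addr0 add0r.
by rewrite lerDr rdot_ge0.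
Qed.

Lemma rdot_residual x : rdot (Q x - w) (Q (res x)) = rdot (res x) (res x).
Proof. by rewrite rdotC rdot_adjoint. Qed.

(** Since |r|^2 = <Q x - w, Q r>, the denominator of the step size vanishes only at a zero
    residual. *)
Lemma Qresidual_eq0 x : Q (res x) = 0 -> res x = 0.
Proof. by move=> Q0; apply: rdot0_eq0; rewrite -rdot_residual Q0 rdot0r. Qed.

Variable u : nat -> U.
Hypothesis hu : steepest_descent Q w u.
Local Notation r n := (res (u n)).

Definition rstep n : R := rdot (r n) (r n) / rdot (Q (r n)) (Q (r n)).

(* At a zero residual the step is 0 / 0 = 0. *)
Lemma descent_step n : u n.+1 = u n - ofR (rstep n) *: r n.
Proof.
rewrite hu; case: eqP => [->|_]; first by rewrite scaler0 subr0.
congr (_ - _ *: _); rewrite /step_size !norm_ofR /rstep -!sqr_rnorm.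
by rewrite !expr2 !ofRM ofRV ofRM.
Qed.

Lemma rstep_ge0 n : 0 <= rstep n.
Proof. by rewrite divr_ge0 ?rdot_ge0. Qed.

Lemma descent_decrease (M : R) n : 0 < M -> (forall x, rnorm (Q x) <= M * rnorm x) ->
  rdot (r n) (r n) / M ^+ 2 <=
  rdot (Q (u n) - w) (Q (u n) - w) - rdot (Q (u n.+1) - w) (Q (u n.+1) - w).
Proof.
move=> M0 QM.
rewrite descent_step linearB linearZ addrAC; have := rdot_residual (u n).
move: (Q (u n) - w) => g gr; rewrite !rdotE (rdotC _ g) gr; move: (rdot g g) => f.
have [Q0|Qn0] := eqVneq (rdot (Q (r n)) (Q (r n))) 0.
  have r0 : r n = 0 by apply/Qresidual_eq0/rdot0_eq0.
  by rewrite /rstep r0 linear0 !rdot0r !(mul0r, mulr0, oppr0, addr0) subrr.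
have Qgt0 : 0 < rdot (Q (r n)) (Q (r n)) by rewrite lt_neqAle eq_sym Qn0 rdot_ge0.
have Qle : rdot (Q (r n)) (Q (r n)) <= M ^+ 2 * rdot (r n) (r n).
  rewrite -!sqr_rnorm -exprMn ler_pXn2r ?nnegrE ?mulr_ge0 ?rnorm_ge0// ?QM//.
  exact: ltW.
rewrite /rstep; move: (rdot (Q (r n)) _) Qn0 Qgt0 Qle => q q0 qgt0.
move: (rdot (r n) _) (rdot_ge0 (r n)) => s s0 qs.
(* A step of length a decreases the objective by 2 a s - a^2 q; here a = s / q. *)
rewrite [leRHS](_ : _ = s ^+ 2 / q); last by field.
rewrite ler_pdivrMr ?exprn_gt0// mulrAC ler_pdivlMr//.
by rewrite expr2 -mulrA ler_wpM2l// mulrC.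
Qed.

(** The objective is nonincreasing and bounded below. Once it is within e / M^2 of its infimum, each
    further decrease is below e / M^2. *)
Lemma residual_cvg0 (e : R) : 0 < e ->
  exists N, forall n, (N <= n)%N -> rdot (r n) (r n) < e.
Proof.
move=> e0; have [M M0 QM] := bounded_rnorm hQ.
pose F n : R := rdot (Q (u n) - w) (Q (u n) - w).
have M2 : 0 < M ^+ 2 by rewrite exprn_gt0.
have Fdecr n : rdot (r n) (r n) / M ^+ 2 <= F n - F n.+1 by apply: descent_decrease.
have FS n : F n.+1 <= F n.
  by rewrite -subr_ge0 (le_trans _ (Fdecr n))// divr_ge0 ?rdot_ge0// ltW.
have Fhomo : {homo F : m n / (m <= n)%N >-> n <= m}.
  by apply: homo_leq => // x y z /[swap]; exact: le_trans.
have Flb : has_lbound (range F) by exists 0 => _ [n _ <-]; exact: rdot_ge0.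
have [|_ [N _ <-] FN] := @inf_adherent _ (range F) (e / M ^+ 2) (divr_gt0 e0 M2).
  by split=> //; exists (F 0%N), 0%N.
exists N => n Nn; rewrite -(@ltr_pM2r _ (M ^+ 2)^-1) ?invr_gt0//.
apply: le_lt_trans (Fdecr n) _; rewrite ltrBlDr.
apply: le_lt_trans (Fhomo _ _ Nn) _; apply: lt_le_trans FN _.
by rewrite addrC lerD2l; apply: ge_inf => //; exists n.+1.
Qed.

(* Log-convexity of the moments [m_j = <(Q^* Q)^j x, x>]: [m_1 m_2 <= m_0 m_3]
   follows from [m_1^2 <= m_0 m_2] and [m_2^2 <= m_1 m_3]. *)
Lemma moment_le x (s := adjoint Q (Q x)) :
  rdot s s * rdot (Q x) (Q x) <= rdot x x * rdot (Q s) (Q s).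
Proof.
have m1 := Cauchy_Schwarz x s; have m2 := Cauchy_Schwarz (Q x) (Q s).
have E1 : rdot x s = rdot (Q x) (Q x) by rewrite rdot_adjoint.
have E2 : rdot (Q x) (Q s) = rdot s s by rewrite rdotC rdot_adjoint.
rewrite E1 in m1; rewrite E2 in m2.
move: m1 m2 (rdot_ge0 x) (rdot_ge0 s) (rdot_ge0 (Q x)) (rdot_ge0 (Q s)).
move: (rdot x x) (rdot s s) (rdot (Q x) (Q x)) (rdot (Q s) (Q s)) => a c b d.
move=> bac cbd a0 c0 b0 d0.
have [->|bn0] := eqVneq b 0; first by rewrite mulr0 mulr_ge0.
have [->|cn0] := eqVneq c 0; first by rewrite mul0r mulr_ge0.
have bc0 : 0 < c * b by rewrite mulr_gt0// lt_neqAle eq_sym ?bn0 ?cn0.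
rewrite -(ler_pM2r bc0) (_ : c * b * (c * b) = b ^+ 2 * c ^+ 2); last by ring.
rewrite (_ : a * d * (c * b) = (a * c) * (b * d)); last by ring.
by rewrite ler_pM// sqr_ge0.
Qed.

(** * Convergence when the initial error lies in the range of the adjoint *)

Section Error.
Variable p : U.
Hypothesis p0 : res p = 0.
Variable d0 : V.
Hypothesis ud0 : u 0%N - p = adjoint Q d0.

Lemma residualE n : r n = adjoint Q (Q (u n - p)).
Proof. by rewrite -residualB p0 subr0. Qed.

Lemma error_preimage n :
  exists2 d, u n - p = adjoint Q d & rdot d d <= rdot d0 d0.
Proof.
elim: n => [|n [d ed dd0]]; first by exists d0.
exists (d - ofR (rstep n) *: Q (u n - p)).
  by rewrite adjointB// adjointZ// -residualE -ed descent_step addrAC.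
apply: le_trans dd0; have s0 := rstep_ge0 n.
rewrite !rdotE (rdotC d) rdot_adjoint// -ed.
have : rstep n * rdot (Q (u n - p)) (Q (u n - p)) <= rdot (u n - p) (u n - p).
  (* A zero denominator makes the step zero, because 0^-1 = 0. *)
  have [q0|qn0] := eqVneq (rdot (Q (r n)) (Q (r n))) 0.
    by rewrite /rstep q0 invr0 mulr0 mul0r rdot_ge0.
  have qgt0 : 0 < rdot (Q (r n)) (Q (r n)) by rewrite lt_neqAle eq_sym qn0 rdot_ge0.
  rewrite /rstep mulrAC ler_pdivrMr// residualE.
  exact: moment_le.
(* With s the step, b = |Q e_n|^2 and c = |e_n|^2 = <d, Q e_n>, the change of |d|^2 is -2 s c + s^2
   b = -s c - s (c - s b). *)
move: (rdot_ge0 (u n - p)) s0.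
move: (rstep n) (rdot d d) (rdot (Q _) (Q _)) (rdot (u n - p) _) => s a b c c0 s0 sbc.
have : 0 <= s * (c - s * b) by rewrite mulr_ge0// subr_ge0.
have : 0 <= s * c by rewrite mulr_ge0.
by lra.
Qed.

(** Squared norms avoid roots: |e|^4 <= |d|^2 |Q e|^2 is squared, |Q e|^4 <= |e|^2 |r|^2 is
    inserted, and a factor |e|^2 is cancelled. *)
Lemma error_le_residual n :
  rdot (u n - p) (u n - p) ^+ 3 <= rdot d0 d0 ^+ 2 * rdot (r n) (r n).
Proof.
have [d ed dd0] := error_preimage n.
have h1 : rdot (u n - p) (u n - p) ^+ 2 <= rdot d d * rdot (Q (u n - p)) (Q (u n - p)).
  by rewrite [in leLHS]ed -rdot_adjoint// rdotC -ed Cauchy_Schwarz.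
have h2 : rdot (Q (u n - p)) (Q (u n - p)) ^+ 2 <= rdot (u n - p) (u n - p) * rdot (r n) (r n).
  by rewrite rdot_adjoint// -residualE Cauchy_Schwarz.
move: h1 h2 dd0 (rdot_ge0 d) (rdot_ge0 (u n - p)) (rdot_ge0 (r n)) (rdot_ge0 (Q (u n - p))).
move: (rdot d d) (rdot (Q _) (Q _)) (rdot (u n - p) _) (rdot d0 d0) (rdot (r n) _).
move=> a b c d' s h1 h2 ad a0 c0 s0 b0.
have [->|cn0] := eqVneq c 0; first by rewrite expr0n mulr_ge0// sqr_ge0.
have cgt0 : 0 < c by rewrite lt_neqAle eq_sym cn0.
rewrite -(ler_pM2l cgt0) -exprS (_ : c ^+ 4 = (c ^+ 2) ^+ 2); last by ring.
apply: (@le_trans _ _ ((d' * b) ^+ 2)).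
  rewrite ler_pXn2r ?nnegrE ?sqr_ge0//; last by rewrite mulr_ge0// (le_trans a0).
  by apply: (le_trans h1); rewrite ler_wpM2r.
by rewrite exprMn [leRHS]mulrCA ler_wpM2l// sqr_ge0.
Qed.

Lemma descent_cvg : u n @[n --> \oo] --> p.
Proof.
apply: cvgPrnorm => e e0.
have D0 : 0 < rdot d0 d0 ^+ 2 + 1 by rewrite ltr_wpDl// sqr_ge0.
(* The bound to reach is |e_n|^6 < e^6; adding 1 to |d_0|^4 keeps the divisor positive. *)
have [N rN] := residual_cvg0 (divr_gt0 (exprn_gt0 6 e0) D0).
exists N => n /rN; rewrite ltr_pdivlMr// => rn.
rewrite -(@ltr_pXn2r _ 6) ?nnegrE ?rnorm_ge0 ?(ltW e0)//.
rewrite (_ : 6 = 2 * 3)%N// exprM sqr_rnorm; apply: le_lt_trans rn.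
apply: (le_trans (error_le_residual n)); rewrite mulrC ler_wpM2l ?rdot_ge0//.
by rewrite lerDl.
Qed.

End Error.

(** * Divergence of the norms in the absence of solutions *)

Lemma bounded_subsequence_solution (K : R) :
  (forall N, exists2 n, (N <= n)%N & rnorm (u n) <= K) ->
  exists p, res p = 0.
Proof.
move=> uK; have [M M0 QM] := bounded_rnorm hQ.
(* The residual map is Lipschitz with constant M^2, which makes its sublevel sets closed; being
   affine, it makes them convex. *)
have resL x y : rnorm (res x) <= rnorm (res y) + M ^+ 2 * rnorm (y - x).
  rewrite -[res x](subrK (res y)) addrC; apply: (le_trans (rnormD _ _)).
  rewrite lerD2l residualB rnormB expr2 -mulrA.
  apply: (le_trans (rnorm_adjoint hQ _ (ltW M0) QM)).
  by rewrite ler_pM2l.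
pose C n := [set x | rnorm (res x) <= n.+1%:R^-1].
have [||||p pC _] := @nested_convex_min _ _ U C (K ^+ 2).
- move=> m n mn x /= /le_trans; apply.
  by rewrite lef_pV2 ?posrE// ler_nat.
- move=> n x y; rewrite /C /= => xC yC.
  have -> : res (ofR 2^-1 *: (x + y)) = ofR 2^-1 *: (res x + res y).
    rewrite -adjointD// -adjointZ//; congr adjoint.
    rewrite linearZ linearD addrACA -opprD scalerBr; congr (_ - _).
    by apply: rdot_inj => z; rewrite !rdotE; field.
  rewrite rnormZ ?invr_ge0// mulrC ler_pdivrMr// mulr_natr mulr2n.
  by apply: (le_trans (rnormD _ _)); rewrite lerD.
- move=> n l ll /=; apply/ler_addgt0Pr => e e0.
  have [x xC xl] := ll (e / M ^+ 2) (divr_gt0 e0 (exprn_gt0 _ M0)).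
  apply: (le_trans (resL l x)); rewrite lerD//.
  by rewrite mulrC -ler_pdivlMr ?exprn_gt0// ltW.
- move=> j.
  (* The threshold is squared because [residual_cvg0] controls the squared norm. *)
  have [N rN] := @residual_cvg0 (j.+1%:R^-1 ^+ 2) ltac:(by rewrite exprn_gt0).
  have [n Nn un] := uK N; exists (u n).
    rewrite /C/= -(@ler_pXn2r _ 2) ?nnegrE ?rnorm_ge0 ?invr_ge0//.
    by rewrite sqr_rnorm ltW// rN.
  rewrite -sqr_rnorm ler_pXn2r ?nnegrE ?rnorm_ge0//.
  exact: le_trans (rnorm_ge0 _) un.
exists p; apply: rnorm0_eq0; apply/eqP; rewrite eq_le rnorm_ge0 andbT leNgt.
apply/negP => /ltr_add_invr[n]; rewrite add0r ltNge => /negP; apply.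
exact: pC.
Qed.

Lemma descent_unbounded : least_squares_solutions Q w = set0 ->
  `|u n| @[n --> \oo] --> +oo.
Proof.
(* If a real A is not eventually a lower bound of the norms, arbitrarily late iterates lie in the
   ball of radius [re A]. *)
move=> S0; apply/cvgryPger => A Ar; apply: contrapT => nA.
have [|p /normal_equation pS] := @bounded_subsequence_solution (re A).
  move=> N; apply: contrapT => nN; apply: nA; exists N => // n /= Nn.
  rewrite -(re_real Ar) norm_ofR ofR_le leNgt; apply/negP => /ltW un.
  by apply: nN; exists n.
by rewrite S0 in pS.
Qed.

(** * Identification of the limit with the projection *)

Lemma projection_least_squares p d : res p = 0 -> u 0%N - p = adjoint Q d ->
  orthogonal_projection (least_squares_solutions Q w) (u 0%N) = p.
Proof.
move=> p0 ud; have pS : least_squares_solutions Q w p by apply/normal_equation.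
apply: get_unique => /=.
  (* Two solutions differ by an element of the kernel of Q, which is orthogonal to the range of the
     adjoint. *)
  split=> // s /normal_equation s0; rewrite ud innerC -inner_adjoint//.
  suff -> : Q (s - p) = 0 by rewrite linear0l; apply/eqP; rewrite sconj_eq0.
  by apply: rdot0_eq0; rewrite rdot_adjoint// -residualB s0 p0 subrr rdot0r.
(* For another candidate q, p - q is orthogonal to u_0 - q by choice of q and to u_0 - p as a kernel
   element, hence to itself. *)
move=> q [qS /(_ p pS) qP].
have q0 : Q (p - q) = 0.
  move/normal_equation: qS => q0.
  by apply: rdot0_eq0; rewrite rdot_adjoint// -residualB q0 p0 subrr rdot0r.
apply/esym/eqP; rewrite -subr_eq0; apply/eqP/rdot0_eq0.
have : rdot (u 0%N - q) (p - q) = 0 by rewrite /rdot qP; case: (k).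
rewrite -[u 0%N](subrK p) -addrA rdotDl ud rdotC -rdot_adjoint// q0 rdot0l.
by rewrite add0r.
Qed.

End Descent.

Theorem corollary6p5 (R : realType) (k : scalar_kind) (U V : hilbertType R k)
    (Q : {linear U -> V}) (hQ : bounded_operator Q) (w : V)
    (u : nat -> U) (hu : steepest_descent Q w u) :
  (least_squares_solutions Q w `&` range (adjoint Q) !=set0 ->
   [set a + b | a in range (adjoint Q)
              & b in orthogonal_complement (range (adjoint Q))] (u 0%N) ->
   u n @[n --> \oo] -->
     orthogonal_projection (least_squares_solutions Q w) (u 0%N))
  /\
  (least_squares_solutions Q w = set0 ->
   `|u n| @[n --> \oo] --> +oo).
Proof.
split; last exact: descent_unbounded.
move=> [z [/(normal_equation hQ) zS [y _ yz]]] [_ [v _ <-]] [b bO vb].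
(* In particular b is orthogonal to Q^* Q b, so |Q b|^2 = 0. *)
have Qb : Q b = 0.
  apply: rdot0_eq0; rewrite rdot_adjoint// /rdot bO; first by case: (k).
  by exists (Q b).
(* Shifting the given solution by b keeps it a solution and removes b from the initial error. *)
have p0 : residual Q w (adjoint Q y + b) = 0.
  by rewrite /residual linearD Qb addr0 yz; exact: zS.
have ud : u 0%N - (adjoint Q y + b) = adjoint Q (v - y).
  by rewrite -vb adjointB// opprD addrACA subrr addr0.
by rewrite (projection_least_squares hQ p0 ud); exact: (descent_cvg hQ hu p0 ud).
Qed.
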